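(* Let $V$ be a real vector space of dimension $n$, let $1\leq m\leq n$ and $k\geq1$ be integers, let $f\in S^k(V^\vee)$, and let $s_f\in\Gamma(G_m(V),S^k(U^\vee))$ be the section given by $s_f(W)=f|_{W^k}$, where $U$ is the tautological bundle on the Grassmannian $G_m(V)$ of $m$-dimensional subspaces of $V$. Let $W\in G_m(V)$ be a zero of $s_f$. Then the intrinsic derivative of $s_f$ at $W$ is the map $D_W(s_f):\mathrm{Hom}(W,V/W)\to\mathbb{R}[W]_k$ given by $$D_W(s_f)(\phi)(w)=k\,\mathfrak{f}(\phi(w))(w)\qquad(\phi\in\mathrm{Hom}(W,V/W),\ w\in W),$$ where $\mathfrak{f}:V/W\to\mathbb{R}[W]_{k-1}$ is the linear map $\mathfrak{f}([v])(w):=f(v,w,\dots,w)$ ($w$ repeated $k-1$ times).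
   Context: Elements of $S^k(V^\vee)$ are symmetric $k$-linear forms on $V$; $\mathbb{R}[W]_j$ is the space of homogeneous polynomials of degree $j$ on $W$, identified with $S^j(W^\vee)$ (a symmetric form $g$ corresponds to the polynomial $w\mapsto g(w,\dots,w)$). The tangent space $T_W(G_m(V))$ is identified with $\mathrm{Hom}(W,V/W)$ in the usual way: given a complement $W'$ of $W$ in $V$, the chart around $W$ assigns to $\phi\in\mathrm{Hom}(W,W')$ its graph in $W\oplus W'=V$, and $W'\simeq V/W$. The intrinsic derivative of a section at a zero is its derivative computed in any local chart and trivialization (independent of choices), viewed as a linear map from the tangent space to the fibre. *)

(* Defs.v *)
From HB Require Import structures.
From mathcomp Require Import all_boot all_order perm all_algebra.
From mathcomp Require Import all_classical all_reals all_analysis.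

Set Implicit Arguments.
Unset Strict Implicit.
Unset Printing Implicit Defensive.

Import Order.TTheory GRing.Theory Num.Theory numFieldNormedType.Exports.
Local Open Scope classical_set_scope.
Import VectorInternalTheory.
Local Open Scope ring_scope.

Section FinDim.
Variables (K : fieldType) (E : lmodType K).

Lemma iso_vector_axiom (U : vectType K) (f : E -> U) (g : U -> E) :
  linear f -> cancel f g -> cancel g f -> Vector.axiom (dim U) E.
Proof.
move=> flin fK gK; exists (v2r \o f).
  by move=> a u v /=; rewrite flin linearP.
exists (g \o r2v) => x /=; first by rewrite v2rK fK.
by rewrite gK r2vK.
Qed.

Lemma inj_vector_axiom (U : vectType K) (f : E -> U) :
  linear f -> injective f -> {d : nat & Vector.axiom d E}.
Proof.
move=> flin finj.
pose P d := `[< exists2 S : {vspace U}, \dim S = d &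
  forall u, u \in S -> exists x, f x = u >].
have f0 : f 0 = 0.
  by have := flin 1 0 0; rewrite !scale1r addr0 -[LHS]addr0 => /addrI.
have exP : exists d, P d.
  exists 0; apply/asboolP; exists 0%VS; first exact: dimv0.
  by move=> u; rewrite memv0 => /eqP ->; exists 0.
have leP d : P d -> (d <= \dim {:U})%N.
  by move=> /asboolP[S <- _]; exact/dimvS/subvf.
have [d /asboolP/cid2[S dS SP] dmax] := ex_maxnP exP leP.
have fS x : f x \in S.
  apply/negPn/negP => fxS.
  suff /dmax : P (\dim (S + <[f x]>)%VS).
    rewrite dimv_disjoint_sum -?dS.
      rewrite dim_vline; case: eqP fxS => [->|_ _]; first by rewrite mem0v.
      by rewrite addn1 ltnn.
    apply/eqP; rewrite -subv0; apply/subvP => u /memv_capP[uS /vlineP[c uE]].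
    rewrite memv0; apply: contraNT fxS => u0.
    have c0 : c != 0 by apply: contraNneq u0 => c0; rewrite uE c0 scale0r.
    by rewrite -[f x](scalerK c0) -uE memvZ.
  apply/asboolP; exists (S + <[f x]>)%VS => // u.
  move=> /memv_addP[s /SP[y <-]] [_ /vlineP[c ->]] ->.
  by exists (c *: x + y); rewrite flin addrC.
have /choice[g gP] (u : subvs_of S) : exists x, f x = vsval u.
  by apply: SP; exact: subvsP.
exists (dim (subvs_of S)).
apply: (@iso_vector_axiom _ (fun x => vsproj S (f x)) g).
- by move=> a u v; rewrite flin linearP.
- by move=> x; apply: finj; rewrite gP vsprojK.
- by move=> u; rewrite gP vsvalK.
Qed.

End FinDim.

Section QuotientSpace.
Variables (K : fieldType) (V : vectType K) (W : {vspace V}).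

Definition quotv : Type :=
  Quotient.quot (pred_of_vspace W : zmodClosed V).

HB.instance Definition _ := EqQuotient.on quotv.
HB.instance Definition _ := GRing.Zmodule.on quotv.

Definition piv (v : V) : quotv := \pi_quotv%qT v.

Lemma piv_eq u v : (piv u == piv v) = (u - v \in W).
Proof.
by have := Quotient.idealrBE (pred_of_vspace W : zmodClosed V) u v => <-.
Qed.

Lemma pivD u v : piv (u + v) = piv u + piv v.
Proof. exact: (Quotient.pi_add (pred_of_vspace W : zmodClosed V)). Qed.

Lemma reprvK (x : quotv) : piv (repr x) = x.
Proof. exact: reprK. Qed.

Definition quotv_scale (a : K) (x : quotv) : quotv := piv (a *: repr x).

Lemma piv_scale a v : quotv_scale a (piv v) = piv (a *: v).
Proof.
by apply/eqP; rewrite piv_eq -scalerBr memvZ // -piv_eq reprvK.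
Qed.

Lemma quotv_scaleA a b x :
  quotv_scale a (quotv_scale b x) = quotv_scale (a * b) x.
Proof. by rewrite -(reprvK x) !piv_scale scalerA. Qed.

Lemma quotv_scale1 : left_id 1 quotv_scale.
Proof. by move=> x; rewrite -(reprvK x) piv_scale scale1r. Qed.

Lemma quotv_scaleDr : right_distributive quotv_scale +%R.
Proof.
by move=> a x y; rewrite -(reprvK x) -(reprvK y) -pivD !piv_scale scalerDr pivD.
Qed.

Lemma quotv_scaleDl x : {morph quotv_scale^~ x : a b / a + b}.
Proof. by move=> a b; rewrite -(reprvK x) !piv_scale scalerDl pivD. Qed.

HB.instance Definition _ := GRing.Zmodule_isLmodule.Build K quotv
  quotv_scaleA quotv_scale1 quotv_scaleDr quotv_scaleDl.

Lemma piv_linear : linear piv.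
Proof. by move=> a u v; rewrite pivD -piv_scale. Qed.

HB.instance Definition _ := GRing.isSemilinear.Build K V quotv _ piv
  (GRing.semilinear_linear piv_linear).

Lemma quotv_vect_iso : Vector.axiom (dim (subvs_of W^C)) quotv.
Proof.
pose p (v : V) : V := v - projv W v.
have pC v : p v \in (W^C)%VS by exact: memv_projC.
have plin : linear p by move=> a u v; rewrite /p linearP scalerBr opprD addrACA.
have p0 v : v \in W -> p v = 0 by move=> vW; rewrite /p projv_id ?subrr.
have pB u v : p (u - v) = p u - p v.
  by rewrite addrC -scaleN1r plin scaleN1r addrC.
pose f (x : quotv) := vsproj W^C (p (repr x)).
have fpi v : f (piv v) = vsproj W^C (p v).
  congr vsproj; apply/eqP; rewrite -subr_eq0 -pB p0 // -piv_eq.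
  by rewrite reprvK.
apply: (@iso_vector_axiom _ _ _ f (fun u => piv (vsval u))).
- move=> a x y; rewrite -(reprvK x) -(reprvK y) -piv_linear !fpi plin.
  by rewrite linearP.
- move=> x; rewrite -{2}(reprvK x) /f vsprojK //; apply/eqP.
  by rewrite piv_eq /p addrAC subrr add0r memvN memv_proj.
- move=> u; rewrite fpi; apply/val_inj; rewrite /= vsprojK //.
  rewrite /p; suff -> : projv W (vsval u) = 0 by rewrite subr0.
  have := memv_projC W (vsval u) => uC; apply/eqP.
  rewrite -memv0 -(capv_compl W); apply/memv_capP; split; first exact: memv_proj.
  by rewrite -[projv W _](subKr (vsval u)) memvB ?subvsP.
Qed.

HB.instance Definition _ := Lmodule_hasFinDim.Build K quotv quotv_vect_iso.

End QuotientSpace.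

Section SymForm.
Variables (R : realType) (k : nat).

Definition multilinear (E : vectType R) (g : ('I_k -> E) -> R) : Prop :=
  forall (x : 'I_k -> E) (i : 'I_k) (a : R) (u v : E),
    g (dfwith x i (a *: u + v)) = a * g (dfwith x i u) + g (dfwith x i v).

Definition symmetric_form (E : vectType R) (g : ('I_k -> E) -> R) : Prop :=
  forall (x : 'I_k -> E) (s : 'S_k), g (fun i => x (s i)) = g x.

Definition is_symform (E : vectType R) : {pred ('I_k -> E) -> R^o} :=
  fun g => `[< multilinear g /\ symmetric_form g >].

Section Def.
Variable E : vectType R.

Record symform : predArgType := SymForm {
  symform_fun :> ('I_k -> E) -> R^o;
  symformP : symform_fun \in @is_symform E }.

HB.instance Definition _ := [isSub of symform for symform_fun].
HB.instance Definition _ := [Choice of symform by <:].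

Lemma is_symform_submod_closed : submod_closed (@is_symform E).
Proof.
split=> [|a g h /asboolP[gm gs] /asboolP[hm hs]]; apply/asboolP; split.
- by move=> x i a u v; rewrite /= addr0 mulr0.
- by [].
- move=> x i b u v; rewrite !fctE gm hm /=.
  by rewrite /GRing.scale /= mulrDr mulrDr [a * (b * _)]mulrCA addrACA.
- by move=> x s; rewrite !fctE gs hs.
Qed.

HB.instance Definition _ := GRing.isSubmodClosed.Build R _ (@is_symform E)
  is_symform_submod_closed.
HB.instance Definition _ := [SubChoice_isSubLmodule of symform by <:].

Lemma symform_multilinear (g : symform) : multilinear g.
Proof. by case: g => g /= /asboolP[]. Qed.

Lemma symform_sym (g : symform) : symmetric_form g.
Proof. by case: g => g /= /asboolP[]. Qed.

Lemma symform_ext (g h : symform) : (forall x, g x = h x) -> g = h.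
Proof. by move=> gh; apply/val_inj/funext. Qed.

Local Notation b := (vbasis {:E}).

Lemma symform_basis_ext (g h : symform) :
  (forall t : 'I_k -> 'I_(\dim {:E}), g (fun i => b`_(t i)) = h (fun i => b`_(t i)))
  -> g = h.
Proof.
move=> gh; apply: symform_ext => x.
suff H j : (j <= k)%N -> forall x : 'I_k -> E,
    (forall i : 'I_k, (j <= i)%N -> exists l : 'I_(\dim {:E}), x i = b`_l) ->
    g x = h x.
  by apply: (H k) => // i; rewrite leqNgt ltn_ord.
elim: j => [_|j IH jk] {}x xb.
  have /choice[t tx] i := xb i (leq0n i).
  by have -> : x = fun i => b`_(t i) by apply/funext.
pose i0 := Ordinal jk.
have H u : u \in {:E}%VS -> g (dfwith x i0 u) = h (dfwith x i0 u).
  move=> uE; rewrite (coord_vbasis uE).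
  elim/big_ind: _ => [|u1 u2 e1 e2|l _].
  - have g0 (f : symform) : f (dfwith x i0 0) = 0.
      have := symform_multilinear f x i0 1 0 0.
      by rewrite scale1r addr0 mul1r -[LHS]addr0 => /addrI.
    by rewrite !g0.
  - by rewrite -[u1]scale1r !symform_multilinear e1 e2.
  - rewrite -[_ *: _]addr0 !symform_multilinear; congr (_ * _ + _).
      apply: IH; first exact: ltnW.
      move=> i; case: dfwithP => [_|i' ii' ji']; first by exists l.
      apply: xb; rewrite ltn_neqAle ji' andbT.
      by apply: contraNneq ii' => e; apply/eqP/val_inj.
    have g0 (f : symform) : f (dfwith x i0 0) = 0.
      have := symform_multilinear f x i0 1 0 0.
      by rewrite scale1r addr0 mul1r -[LHS]addr0 => /addrI.
    by rewrite !g0.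
have <- : dfwith x i0 (x i0) = x by apply/funext => i; case: dfwithP.
exact/H/memvf.
Qed.

Lemma symform_vect_iso : {d : nat & Vector.axiom d symform}.
Proof.
pose f (g : symform) : {ffun {ffun 'I_k -> 'I_(\dim {:E})} -> R^o} :=
  [ffun t : {ffun 'I_k -> 'I_(\dim {:E})} => g (fun i => b`_(t i))].
apply: (@inj_vector_axiom _ _ _ f).
  by move=> a g h; apply/ffunP => t; rewrite !ffunE.
move=> g h /ffunP gh; apply: symform_basis_ext => t.
have := gh (finfun t); rewrite !ffunE.
by under eq_fun do rewrite ffunE.
Qed.

HB.instance Definition _ := Lmodule_hasFinDim.Build R symform
  (projT2 symform_vect_iso).

End Def.
End SymForm.

Section Pullback.
Variables (R : realType) (k : nat) (E F : vectType R) (l : 'Hom(E, F)).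

Lemma pullback_subproof (g : symform k F) :
  (fun x : 'I_k -> E => g (fun i => l (x i))) \in @is_symform R k E.
Proof.
apply/asboolP; split=> [x i a u v|x s]; last first.
  exact: (symform_sym g (fun i => l (x i))).
have H w : (fun j => l (dfwith x i w j)) = dfwith (fun j => l (x j)) i (l w).
  apply/funext => j; case: dfwithP => [|j' ij]; first by rewrite dfwithin.
  by rewrite dfwithout.
by rewrite !H linearP symform_multilinear.
Qed.

Definition pullback (g : symform k F) : symform k E :=
  SymForm (pullback_subproof g).

End Pullback.

(* The homogeneous polynomial of degree [k] on [E] attached to [g]; by
   polarization, [symform k E] is also the space of these polynomials. *)
Definition poly_eval (R : realType) (k : nat) (E : vectType R)
  (g : symform k E) (w : E) : R := g (fun=> w).

Section Smooth.
Variables (R : realType) (p q : nat).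

Fixpoint Cdiff (r : nat) (A : set 'rV[R]_p) (f : 'rV[R]_p -> 'rV[R]_q) : Prop :=
  match r with
  | 0%N => forall x, A x -> {for x, continuous f}
  | r'.+1 => (forall x, A x -> differentiable f x) /\
             (forall v, Cdiff r' A (fun x => 'd f x v))
  end.

(* [A] is meant to be open. *)
Definition smooth_on (A : set 'rV[R]_p) (f : 'rV[R]_p -> 'rV[R]_q) : Prop :=
  forall r, Cdiff r A f.

End Smooth.

Section Grassmannian.
Variables (R : realType) (V : vectType R).

Record grass (m : nat) : predArgType := Grass {
  grass_vs :> {vspace V};
  grass_dim : \dim grass_vs == m }.

HB.instance Definition _ m := [isSub of grass m for @grass_vs m].

Definition complement (W W' : {vspace V}) : bool :=
  ((W + W')%VS == fullv) && ((W :&: W')%VS == 0%VS).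

Definition inclusion (W : {vspace V}) : 'Hom(subvs_of W, V) := linfun vsval.

Section Graph.
Variables (W W' : {vspace V}).

Definition graph_map (phi : 'Hom(subvs_of W, subvs_of W')) :
    'Hom(subvs_of W, V) := inclusion W + (inclusion W' \o phi)%VF.

Definition graph_vs (phi : 'Hom(subvs_of W, subvs_of W')) : {vspace V} :=
  limg (graph_map phi).

Lemma dim_graph_vs phi : complement W W' -> \dim (graph_vs phi) = \dim W.
Proof.
case/andP => _ /eqP WW'.
rewrite /graph_vs limg_dim_eq; first by rewrite dimvf.
apply/eqP; rewrite -subv0; apply/subvP => w /memv_capP[_].
rewrite memv_ker /graph_map add_lfunE comp_lfunE !lfunE /= addr_eq0 memv0 => /eqP e.
suff : vsval w \in (W :&: W')%VS.
  by rewrite WW' memv0 => /eqP w0; apply/eqP/val_inj.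
by apply/memv_capP; split; [exact: subvsP | rewrite e memvN subvsP].
Qed.

(* The tangent vector at [W] of the curve [t |-> graph_vs (t *: phi)], in
   Hom(W, V/W). *)
Definition tangent (phi : 'Hom(subvs_of W, subvs_of W')) :
    'Hom(subvs_of W, quotv W) := (linfun (piv W) \o (inclusion W' \o phi))%VF.

End Graph.

Section Bundle.
Variables (m k : nat) (W : grass m) (W' : {vspace V}).
Hypothesis WW' : complement W W'.

Lemma dim_graph phi : \dim (@graph_vs W W' phi) == m.
Proof. by rewrite dim_graph_vs // grass_dim. Qed.

Definition graph phi : grass m := Grass (dim_graph phi).

Local Notation H := ('Hom(subvs_of W, subvs_of W')).

(* The graph chart around [W] given by [W'], read backwards, with the linear
   coordinates [v2r] on Hom(W, W'). *)
Definition graph_coord (x : 'rV[R]_(dim H)) : grass m := graph (r2v x).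

(* [kappa] restricts to a smooth chart around [W], with inverse [psi]: near [W]
   the transition map from the graph chart is a diffeomorphism from [A] onto
   [B] with inverse [b]. *)
Definition local_chart (N : nat) (kappa : grass m -> 'rV[R]_N)
    (psi : 'rV[R]_N -> grass m) : Prop :=
  exists (A : set 'rV[R]_(dim H)) (B : set 'rV[R]_N)
         (b : 'rV[R]_N -> 'rV[R]_(dim H)),
  [/\ [/\ open A, open B & A 0],
      smooth_on A (kappa \o graph_coord),
      smooth_on B b,
      forall x, A x -> B (kappa (graph_coord x)) /\ b (kappa (graph_coord x)) = x
    & forall y, B y -> [/\ A (b y), psi y = graph_coord (b y)
                         & kappa (psi y) = y]].

(* Projection along [W']; on the graph of [phi] it is the inverse of
   [w |-> w + phi w], so it identifies the tautological bundle over the domain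
   of the graph chart with the constant bundle of fibre [W]. *)
Definition graph_proj (X : grass m) : 'Hom(subvs_of X, subvs_of W) :=
  (linfun (vsproj W) \o (daddv_pi W W' \o inclusion X))%VF.

(* [tau] is a linear trivialization near [W], smooth in the frames
   [X |-> pullback (graph_proj X) g] of the bundle of symmetric forms.  Since
   the fibres are finite dimensional, testing on each [g] is the same as asking
   the transition function to be smooth as a map into linear isomorphisms. *)
Definition local_trivialization (M : nat)
    (tau : forall X : grass m, 'Hom(symform k (subvs_of X), 'rV[R]_M)) : Prop :=
  exists A : set 'rV[R]_(dim H),
  [/\ open A, A 0,
      forall x, A x -> bijective (tau (graph_coord x))
    & forall g : symform k (subvs_of W),
        smooth_on A (fun x => tau (graph_coord x)
                                (pullback (graph_proj (graph_coord x)) g))].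

End Bundle.

Section IntrinsicDerivative.
Variables (m k : nat).

(* A section of the bundle of symmetric k-linear forms on the tautological
   bundle; no regularity is imposed. *)
Definition section : Type := forall X : grass m, symform k (subvs_of X).

Definition restriction_section (f : symform k V) : section :=
  fun X => pullback (inclusion X) f.

(* [D] is the derivative of [s] at a zero [W], whichever chart and
   trivialization are used to compute it: [sigma] is the local expression of
   [s], a tangent vector [tangent phi] has coordinates
   ['d (kappa \o graph_coord) 0 (v2r phi)] in the chart [kappa], and the fibre at
   [W] is identified with [R^M] by [tau W].  Smoothness of charts and
   trivializations is tested near [W] in one graph chart around [W]; the graph
   charts of two complements of [W] differ by a rational diffeomorphism near
   [W], so which complement is used does not restrict them. *)
Definition intrinsic_derivative (s : section) (W : grass m)
    (D : 'Hom('Hom(subvs_of W, quotv W), symform k (subvs_of W))) : Prop :=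
  forall (W' : {vspace V}) (WW' : complement W W')
    (N : nat) (kappa : grass m -> 'rV[R]_N) (psi : 'rV[R]_N -> grass m)
    (M : nat) (tau : forall X : grass m, 'Hom(symform k (subvs_of X), 'rV[R]_M)),
  local_chart WW' kappa psi -> local_trivialization WW' tau ->
  let sigma := fun y => tau (psi y) (s (psi y)) in
  differentiable sigma (kappa W) /\
  forall phi : 'Hom(subvs_of W, subvs_of W'),
    'd sigma (kappa W) ('d (kappa \o graph_coord WW') 0 (v2r phi)) =
    tau W (D (tangent phi)).

End IntrinsicDerivative.
End Grassmannian.

(* Main.v *)
From HB Require Import structures.
Require Import Defs.
From mathcomp Require Import all_boot all_order perm all_algebra.
From mathcomp Require Import all_classical all_reals all_analysis.

(* In the graph chart given by a complement W', and after pulling the fibres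
   back to W along W', the section becomes the map
     phi |-> (w |-> f(w + phi w, ..., w + phi w)),
   whose derivative at 0 replaces one argument w at a time by phi w.  As f
   vanishes on W, only the class of phi w in V/W matters.  A change of
   trivialization only contributes, by the product rule, a multiple of the
   value of the section at W, which is 0; a change of chart is the chain rule.
   For uniqueness it is enough to exhibit one chart and one trivialization. *)

Set Implicit Arguments.
Unset Strict Implicit.
Unset Printing Implicit Defensive.

Import Order.TTheory GRing.Theory Num.Theory numFieldNormedType.Exports.
Local Open Scope classical_set_scope.
Import VectorInternalTheory.
Local Open Scope ring_scope.

(** * Differential calculus in normed spaces and row vectors *)

Section IsDiff.
Variables (R : realType).

(** A differential is a little-o condition at the point, so it only sees the germ of the map. This
    transfers identities that hold merely on the open sets of a chart. *)
Lemma is_diff_near_eq (E F : normedModType R) (f g df : E -> F) (x : E) :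
  is_diff x f df -> (\forall z \near x, f z = g z) -> is_diff x g df.
Proof.
move=> fx fg.
have fgx : f x = g x by exact: nbhs_singleton fg.
have H : g \o shift x = cst (g x) + 'd f x +o_ (0 : E) id.
  apply/eqaddoP => e e0.
  have /eqaddoP/(_ e e0) := diff_locally (@ex_diff _ _ _ _ _ _ _ fx).
  rewrite -fgx; apply: filter_app.
  move: fg; rewrite (near_shift 0 x); apply: filterS => h /=.
  by rewrite subr0 !fctE /= => ->.
have dg : 'd g x = 'd f x :> (E -> F).
  by apply: diff_unique H; exact/diff_continuous/ex_diff.
split.
  apply/diff_locallyP; rewrite dg; split => //; exact/diff_continuous/ex_diff.
by rewrite dg diff_val.
Qed.

Lemma is_diff_sum (E F : normedModType R) (I : Type) (r : seq I)
  (P : pred I) (f df : I -> E -> F) (x : E) :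
  (forall i, P i -> is_diff x (f i) (df i)) ->
  is_diff x (fun z => \sum_(i <- r | P i) f i z)
    (fun z => \sum_(i <- r | P i) df i z).
Proof.
move=> H.
have -> : (fun z => \sum_(i <- r | P i) f i z) = \sum_(i <- r | P i) f i.
  by apply/funext => z; rewrite fct_sumE.
have -> : (fun z => \sum_(i <- r | P i) df i z) = \sum_(i <- r | P i) df i.
  by apply/funext => z; rewrite fct_sumE.
elim/big_ind2: _ => // [|? ? ? ? ? ?]; first exact: is_diff_cst.
exact: is_diffD.
Qed.

Lemma is_diff_scalel_comp (E F : normedModType R) (u du : E -> R) (a : F)
  (x : E) :
  is_diff x u du -> is_diff x (fun z => u z *: a) (fun z => du z *: a).
Proof.
move=> ux; split; first exact/differentiableZl/ex_diff.
by rewrite diffZl ?diff_val.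
Qed.

(** Continuity is where finite dimension enters: [L] is a combination of the coordinate functions
    with constant vectors. *)
Lemma is_diff_linear (p : nat) (F : normedModType R)
  (L : {linear 'rV[R]_p -> F}) (x : 'rV[R]_p) : is_diff x L L.
Proof.
have LE z : L z = \sum_j z 0 j *: L (delta_mx 0 j).
  rewrite {1}[z]row_sum_delta linear_sum; apply: eq_bigr => j _.
  by rewrite linearZ.
have Lc : continuous L.
  move=> z; apply: differentiable_continuous.
  rewrite (_ : (L : _ -> F) = fun z => \sum_j z 0 j *: L (delta_mx 0 j));
    last exact/funext.
  suff [] : is_diff z (fun z => \sum_j z 0 j *: L (delta_mx 0 j))
      (fun h => \sum_j 'd (fun y : 'rV[R]_p => y 0 j : R) z h *:
                  L (delta_mx 0 j)) by [].
  apply: is_diff_sum => j _; apply: is_diff_scalel_comp.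
  exact/differentiableP/differentiable_coord.
by split; [exact: linear_differentiable|rewrite diff_lin].
Qed.

(** Expanding [g] in the standard basis reduces this to the product rule for real functions, one
    coordinate at a time. *)
Lemma is_diff_scale (E : normedModType R) q (u du : E -> R)
  (g dg : E -> 'rV[R]_q) (x : E) :
  is_diff x u du -> is_diff x g dg ->
  is_diff x (fun z => u z *: g z) (fun z => du z *: g x + u x *: dg z).
Proof.
move=> ux gx.
have cx j : is_diff x (fun z => g z 0 j) (fun z => dg z 0 j).
  pose c (M : 'rV[R]_q) : R := M 0 j.
  have clin : linear c by move=> a A B; rewrite /c !mxE.
  pose cM := GRing.isLinear.Build _ _ _ _ _ clin.
  pose cL : {linear _ -> R} := HB.pack c cM.
  have dc : is_diff (g x) c c := is_diff_linear cL (g x).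
  exact: (is_diff_comp gx dc).
have -> : (fun z => u z *: g z) =
    fun z => \sum_j (u z * g z 0 j) *: delta_mx 0 j.
  apply/funext => z; rewrite [g z in LHS]row_sum_delta scaler_sumr.
  by apply: eq_bigr => j _; rewrite scalerA.
have -> : (fun z => du z *: g x + u x *: dg z) =
    fun z => \sum_j (u x * dg z 0 j + g x 0 j * du z) *: delta_mx 0 j.
  apply/funext => z.
  rewrite [g x in LHS]row_sum_delta [dg z in LHS]row_sum_delta !scaler_sumr.
  rewrite -big_split; apply: eq_bigr => j _ /=.
  by rewrite !scalerA -scalerDl addrC [du z * _]mulrC.
apply: is_diff_sum => j _; apply: is_diff_scalel_comp.
exact: (is_diffM ux (cx j)).
Qed.

(* The differential in is_diff carries the filter of the normed module, the one
   in the conclusion that of the matrix type; the two are only convertible. *)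
Lemma is_diff_rV p q (f df : 'rV[R]_p -> 'rV[R]_q) (x : 'rV[R]_p) :
  is_diff x f df -> differentiable f x /\ forall h, 'd f x h = df h.
Proof.
move=> fx; split=> [|h]; first exact: (@ex_diff _ _ _ _ _ _ _ fx).
by rewrite -[df]diff_val.
Qed.

End IsDiff.

(** * Replacing one entry of a family *)

Section Dfwith.
Variables (I : eqType) (E F : Type).
Implicit Types (x : I -> E) (i j : I).

Lemma dfwith_comp (l : E -> F) x i u :
  (fun j => l (dfwith x i u j)) = dfwith (fun j => l (x j)) i (l u).
Proof.
by apply/funext => j; case: dfwithP => [|j' ij]; rewrite ?dfwithin ?dfwithout.
Qed.

Lemma dfwith_id x i : dfwith x i (x i) = x.
Proof. by apply/funext => j; case: dfwithP. Qed.

Lemma dfwith_dfwith x i u v : dfwith (dfwith x i u) i v = dfwith x i v.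
Proof.
by apply/funext => j; case: dfwithP => [|j' ij]; rewrite ?dfwithin ?dfwithout.
Qed.

Lemma dfwithC x i j u v : i != j ->
  dfwith (dfwith x i u) j v = dfwith (dfwith x j v) i u.
Proof.
move=> ij; apply/funext => h.
case: dfwithP => [|h' jh].
  by rewrite dfwithout // dfwithin.
case: (eqVneq i h') => [<-|ih]; first by rewrite !dfwithin.
by rewrite !dfwithout.
Qed.

End Dfwith.

Lemma eq_dfwith (I : eqType) (E : Type) (x y : I -> E) i u :
  (forall j, j != i -> x j = y j) ->   dfwith x i u = dfwith y i u.
Proof.
move=> xy; apply/funext => j.
case: dfwithP => [|j' ij]; first by rewrite dfwithin.
by rewrite dfwithout // xy // eq_sym.
Qed.

(** * Multilinear forms and their Leibniz rule *)

Section Multilinear.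
Variables (R : realType) (k : nat) (E : vectType R) (g : ('I_k -> E) -> R).
Hypothesis gm : multilinear g.

Lemma multilinearD x i u v :
  g (dfwith x i (u + v)) = g (dfwith x i u) + g (dfwith x i v).
Proof. by rewrite -[u]scale1r gm mul1r scale1r. Qed.

Lemma multilinear0 x i : g (dfwith x i 0) = 0.
Proof.
have := multilinearD x i 0 0.
by rewrite addr0 -[LHS]addr0 => /addrI.
Qed.

Lemma multilinearZ x i a u : g (dfwith x i (a *: u)) = a * g (dfwith x i u).
Proof. by rewrite -[a *: u]addr0 gm multilinear0 addr0. Qed.

Lemma multilinear_sum x i (J : Type) (r : seq J) (P : pred J) (u : J -> E) :
  g (dfwith x i (\sum_(j <- r | P j) u j)) =
  \sum_(j <- r | P j) g (dfwith x i (u j)).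
Proof.
elim/big_ind2: _ => // [|u1 a1 u2 a2 <- <-]; first exact: multilinear0.
exact: multilinearD.
Qed.

Lemma multilinear_basis x i u :
  g (dfwith x i u) =
  \sum_l coord (vbasis {:E}) l u * g (dfwith x i (vbasis {:E})`_l).
Proof.
rewrite {1}(coord_vbasis (memvf u)) multilinear_sum.
by apply: eq_bigr => l _; rewrite multilinearZ.
Qed.

Lemma multilinear_is_diff (p : nat) (a : 'I_k -> E)
  (L : 'I_k -> 'rV[R]_p -> E) :
  (forall i, linear (L i)) ->
  is_diff (0 : 'rV[R]_p) (fun x => g (fun i => a i + L i x))
    (fun h => \sum_i g (dfwith a i (L i h))).
Proof.
move=> Llin.
(* Only the first j slots vary: induction on j. *)
pose M j b x : 'I_k -> E := fun i => if (i < j)%N then b i + L i x else b i.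
have L0 i : L i 0 = 0.
  by have := Llin i 1 0 0; rewrite scale1r addr0 scale1r -[LHS]addr0 => /addrI.
have M0 j b : M j b 0 = b.
  by apply/funext => i; rewrite /M L0 addr0; case: ifP.
suff H j b : (j <= k)%N -> is_diff (0 : 'rV[R]_p) (fun x => g (M j b x))
    (fun h => \sum_(i < k | (i < j)%N) g (dfwith b i (L i h))).
  have := H k a (leqnn k).
  under eq_fun do (rewrite /M; under eq_fun do rewrite ltn_ord).
  by under [X in is_diff _ _ X]eq_fun do (under eq_bigl do rewrite ltn_ord).
(* The base tuple [b] stays general because the step puts basis vectors into its slot [j]. *)
elim: j b => [|j IH] b jk.
  have -> : (fun h => \sum_(i < k | (i < 0)%N) g (dfwith b i (L i h))) = 0.
    by apply/funext => h; rewrite big_pred0.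
  exact: (is_diff_cst (g b) 0).
pose i0 := Ordinal jk.
pose c l x := coord (vbasis {:E}) l (L i0 x).
pose bl l := dfwith b i0 (vbasis {:E})`_l.
have Mdf x u : dfwith (M j b x) i0 u = M j (dfwith b i0 u) x.
  apply/funext => i; rewrite /M; case: dfwithP => [|i' ii'].
    by rewrite ltnn dfwithin.
  by rewrite dfwithout.
have ME x : M j.+1 b x = dfwith (M j b x) i0 (M j b x i0 + L i0 x).
  apply/funext => i; rewrite /M /= ltnn; case: dfwithP => [|i' ii'].
    by rewrite leqnn.
  rewrite ltnS leq_eqVlt; case: eqP => // ij.
  by case/eqP: ii'; apply/val_inj.
(* The increment [L i0 x] of the new slot is expanded in a basis. Each term is then a linear
   functional [c l] times a form in which only the first [j] slots vary, which the induction
   hypothesis covers. *)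
have -> : (fun x => g (M j.+1 b x)) =
    (fun x => g (M j b x)) + (fun x => \sum_l c l x * g (M j (bl l) x)).
  apply/funext => x; rewrite ME multilinearD dfwith_id fctE.
  rewrite [X in _ + X]multilinear_basis; congr (_ + _); apply: eq_bigr => l _.
  by rewrite Mdf.
(* The target takes the shape of the product rule; its first summand vanishes since [c l 0 = 0]. *)
have -> : (fun h => \sum_(i < k | (i < j.+1)%N) g (dfwith b i (L i h))) =
    (fun h => \sum_(i < k | (i < j)%N) g (dfwith b i (L i h))) +
    (fun h => \sum_l
      (c l 0 * \sum_(i < k | (i < j)%N) g (dfwith (bl l) i (L i h)) +
       g (M j (bl l) 0) * c l h)).
  apply/funext => h; rewrite (bigD1 i0) ?leqnn //= fctE addrC; congr (_ + _).
    apply: eq_bigl => i; rewrite ltnS [RHS]ltn_neqAle andbC; congr (_ && _).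
  rewrite multilinear_basis; apply: eq_bigr => l _.
  by rewrite /c L0 linear0 mul0r add0r M0 mulrC.
have cdiff l : is_diff (0 : 'rV[R]_p) (c l) (c l).
  have clin : linear (c l) by move=> e A B; rewrite /c Llin linearP.
  pose cM := GRing.isLinear.Build _ _ _ _ _ clin.
  pose cL : {linear _ -> R} := HB.pack (c l) cM.
  exact: (is_diff_linear cL).
apply: is_diffD; first exact/IH/ltnW.
apply: is_diff_sum => l _.
exact: (is_diffM (cdiff l) (IH _ (ltnW jk))).
Qed.

End Multilinear.

(** * Symmetric forms: generators, pullback and its derivative *)

Section SymformFacts.
Variables (R : realType) (k : nat).

Section Eval.
Variable E : vectType R.
Implicit Types (g h : symform k E) (x : 'I_k -> E).

Lemma symformD g h x : (g + h) x = g x + h x. Proof. by []. Qed.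

Lemma symformZ (c : R) g x : (c *: g) x = c * g x. Proof. by []. Qed.

(** Evaluation on basis tuples is linear and injective; a linear left inverse applied to the
    indicator functions gives the [e t]. They generate, with no claim of independence, and turn a
    varying form into real coefficients times fixed forms. *)
Lemma symform_generators :
  exists e : {ffun 'I_k -> 'I_(\dim {:E})} -> symform k E,
    forall g, g = \sum_(t : {ffun 'I_k -> 'I_(\dim {:E})})
                    g (fun i => (vbasis {:E})`_(t i)) *: e t.
Proof.
pose T := {ffun 'I_k -> 'I_(\dim {:E})}.
pose F g : {ffun T -> R^o} := [ffun t : T => g (fun i => (vbasis {:E})`_(t i))].
have Flin : linear F by move=> c g h; apply/ffunP => t; rewrite !ffunE.
pose FM := GRing.isLinear.Build _ _ _ _ _ Flin.
pose FL : {linear symform k E -> {ffun T -> R^o}} := HB.pack F FM.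
have FK : cancel (linfun FL) (linfun FL)^-1%VF.
  apply: lker0_lfunK; apply/lker0P => g h; rewrite !lfunE /= => /ffunP gh.
  apply: symform_basis_ext => t; have := gh (finfun t); rewrite !ffunE.
  by under eq_fun do rewrite ffunE.
exists (fun t => (linfun FL)^-1%VF [ffun u => (u == t)%:R]) => g.
rewrite -{1}[g]FK lfunE /=.
have -> : F g = \sum_t F g t *: [ffun u => (u == t)%:R].
  apply/ffunP => u; rewrite sum_ffunE (bigD1 u) //= big1 => [|t tu].
    by rewrite addr0 [in RHS]/GRing.scale /= !ffunE eqxx [RHS]mulr1.
  by rewrite !ffunE eq_sym (negPf tu) [LHS]mulr0.
rewrite linear_sum; apply: eq_bigr => t _.
by rewrite linearZ ffunE.
Qed.

End Eval.

Section Derivative.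
Variables (E F : vectType R) (l : 'Hom(E, F)).

(** The formula is the derivative at [l], in the direction [theta], of the pullback of [g]. A
    permutation of the arguments permutes the summands, whence symmetry; slot [i] enters through
    [theta] in summand [i] and through [l] in the others, linearly each time. *)
Lemma pullback_derive_subproof (theta : 'Hom(E, F)) (g : symform k F) :
  (fun w : 'I_k -> E => \sum_i g (dfwith (fun j => l (w j)) i (theta (w i))))
    \in @is_symform R k E.
Proof.
have gm := symform_multilinear g.
apply/asboolP; split=> [w i a u v|w s].
  rewrite mulr_sumr -big_split; apply: eq_bigr => j _ /=.
  rewrite !(dfwith_comp l).
  have [<-|ij] := eqVneq i j.
    by rewrite !dfwithin !dfwith_dfwith linearP gm.
  by rewrite !dfwithout // !(@dfwithC _ _ _ i j) // linearP gm.
rewrite [RHS](reindex_inj (@perm_inj _ s)) /=; apply: eq_bigr => i _.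
rewrite -(symform_sym g (dfwith _ (s i) _) s); congr (g _); apply/funext => j.
have [<-|ij] := eqVneq i j; first by rewrite !dfwithin.
by rewrite !dfwithout // (inj_eq perm_inj).
Qed.

Definition pullback_derive theta g : symform k E :=
  SymForm (pullback_derive_subproof theta g).

Lemma pullback_derive_linear g : linear (pullback_derive^~ g).
Proof.
move=> a t1 t2; apply: symform_ext => w.
rewrite symformD symformZ /= mulr_sumr -big_split; apply: eq_bigr => i _ /=.
by rewrite add_lfunE scale_lfunE (symform_multilinear g).
Qed.

End Derivative.

Section Pullback.
Variables (E F : vectType R).

Lemma pullback_linear (l : 'Hom(E, F)) : linear (@pullback R k E F l).
Proof. by move=> a g h; apply: symform_ext. Qed.

HB.instance Definition _ l :=
  GRing.isLinear.Build R (symform k F) (symform k E) _ (pullback l)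
    (pullback_linear l).

Lemma pullback_comp (G : vectType R) (l : 'Hom(E, F)) (l' : 'Hom(F, G)) g :
  pullback (l' \o l)%VF g = pullback l (pullback l' g) :> symform k E.
Proof.
apply: symform_ext => w /=; congr (g _); apply/funext => i.
by rewrite comp_lfunE.
Qed.

End Pullback.

Lemma pullback1 (E : vectType R) (g : symform k E) : pullback \1%VF g = g.
Proof.
by apply: symform_ext => w /=; congr (g _); apply/funext => i; rewrite id_lfunE.
Qed.

(** On the diagonal, a transposition carries the summand of any slot to that of slot [i], so all [k]
    summands agree. This is the source of the factor [k]. *)
Lemma poly_eval_pullback_derive (E F : vectType R) (l theta : 'Hom(E, F))
  (g : symform k F) w i :
  poly_eval (pullback_derive l theta g) w =
    k%:R * g (dfwith (fun=> l w) i (theta w)).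
Proof.
rewrite /poly_eval /=.
have H (j : 'I_k) :
    g (dfwith (fun=> l w) j (theta w)) = g (dfwith (fun=> l w) i (theta w)).
  rewrite -(symform_sym g (dfwith _ i _) (tperm i j)).
  congr (g _); apply/funext => h.
  case: tpermP => [->|->|/eqP hi /eqP hj]; last by rewrite !dfwithout // eq_sym.
    have [->|ij] := eqVneq i j; first by [].
    by rewrite !dfwithout // eq_sym.
  by rewrite !dfwithin.
rewrite (eq_bigr _ (fun j _ => H j)) sumr_const card_ord.
by rewrite -[LHS]mulr_natl.
Qed.

End SymformFacts.

(** * Contraction of a symmetric form with a vector *)

Section Contraction.
Variables (R : realType) (k : nat) (E F : vectType R) (l : 'Hom(E, F)).

Definition fcons (T : Type) (v : T) (x : 'I_k -> T) : 'I_k.+1 -> T :=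
  fun i => oapp x v (unlift ord0 i).

(** Exposes slot 0 to multilinearity; the entry 0 is a placeholder that [dfwith] overwrites. *)
Lemma fconsE (v : F) (x : 'I_k -> F) : fcons v x = dfwith (fcons 0 x) ord0 v.
Proof.
apply/funext => i; rewrite /fcons.
case: dfwithP => [|j]; first by rewrite unlift_none.
by case/unlift_some => h -> /= ->.
Qed.

Lemma fcons_dfwith (T : Type) (v : T) (x : 'I_k -> T) i u :
  fcons v (dfwith x i u) = dfwith (fcons v x) (lift ord0 i) u.
Proof.
apply/funext => j; case: dfwithP => [|j'].
  by rewrite /fcons liftK /= dfwithin.
rewrite /fcons; case: unliftP => [h ->|-> //] /=.
by rewrite (inj_eq (@lift_inj _ _)) => ih; rewrite dfwithout.
Qed.

(** Symmetry: a permutation of the last [k] slots extends to one of [k.+1] slots that fixes the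
    first, where [v] sits. *)
Lemma contract_subproof (v : F) (g : symform k.+1 F) :
  (fun x : 'I_k -> E => g (fcons v (fun i => l (x i)))) \in @is_symform R k E.
Proof.
apply/asboolP; split=> [x i a u w|x s].
  by rewrite !(dfwith_comp l) !fcons_dfwith linearP (symform_multilinear g).
rewrite -(symform_sym g (fcons v (fun i => l (x i))) (lift_perm ord0 ord0 s)).
congr (g _); apply/funext => j; rewrite /fcons.
case: (unliftP ord0 j) => [h ->|->]; first by rewrite lift_perm_lift !liftK.
by rewrite lift_perm_id unlift_none.
Qed.

Definition contract v g : symform k E := SymForm (contract_subproof v g).

Lemma contract_linear g : linear (contract^~ g).
Proof.
move=> a u v; apply: symform_ext => x; rewrite symformD symformZ /=.
by rewrite fconsE (symform_multilinear g) -!fconsE.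
Qed.

End Contraction.

(** * Graph charts and projection along a complement *)

Section Graph.
Variables (R : realType) (V : vectType R) (m : nat) (W : grass V m).
Variables (W' : {vspace V}) (WW' : complement W W').
Local Notation H := 'Hom(subvs_of W, subvs_of W').

Let WI : (W :&: W' = 0)%VS. Proof. by case/andP: WW' => _ /eqP. Qed.

Lemma inclusionE (U : {vspace V}) u : inclusion U u = vsval u.
Proof. by rewrite lfunE. Qed.

Lemma graph_mapE (phi : H) w : graph_map phi w = vsval w + vsval (phi w).
Proof. by rewrite add_lfunE comp_lfunE !inclusionE. Qed.

Lemma daddv_pi_graph (phi : H) w : daddv_pi W W' (graph_map phi w) = vsval w.
Proof.
rewrite graph_mapE linearD /= daddv_pi_id ?subvsP //.
(* The projections onto [W] and [W'] sum to the identity, and the second fixes [phi w]; hence the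
   first kills it. *)
rewrite -[X in _ + X = _](addrK (vsval (phi w))).
have := @daddv_pi_add _ _ W W' (vsval (phi w)) WI.
rewrite (@daddv_pi_id _ _ W' W) ?subvsP 1?capvC // => ->.
  by rewrite subrr addr0.
by rewrite (subvP (addvSr _ _)) ?subvsP.
Qed.


Lemma graph_map_proj (phi : H) (u : subvs_of (graph WW' phi)) :
  graph_map phi (graph_proj W W' (graph WW' phi) u) = vsval u.
Proof.
have /memv_imgP[w _ uE] : vsval u \in limg (graph_map phi) by exact: subvsP.
rewrite uE; congr (graph_map phi _); apply/val_inj.
rewrite !comp_lfunE !lfunE /= vsprojK ?memv_pi //.
by move: uE; rewrite /= => ->; rewrite daddv_pi_graph.
Qed.

Lemma graph_proj_map (phi : H) w (u : subvs_of (graph WW' phi)) :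
  vsval u = graph_map phi w -> graph_proj W W' (graph WW' phi) u = w.
Proof.
move=> uE; apply/val_inj.
by rewrite !comp_lfunE !lfunE /= vsprojK ?memv_pi // uE daddv_pi_graph.
Qed.

Lemma graph_proj_lker0 (phi : H) :
  lker (graph_proj W W' (graph WW' phi)) == 0%VS.
Proof.
apply/lker0P => u v uv; apply/val_inj.
by rewrite -[LHS]graph_map_proj uv graph_map_proj.
Qed.

Lemma graph_proj_full (phi : H) :
  limg (graph_proj W W' (graph WW' phi)) = fullv.
Proof.
apply/vspaceP => w; rewrite memvf; apply/memv_imgP.
have wG : graph_map phi w \in graph WW' phi by exact/memv_img/memvf.
exists (vsproj _ (graph_map phi w)); first exact: memvf.
by apply/esym/graph_proj_map; rewrite vsprojK.
Qed.

(** Projecting a point of the graph to [W] recovers its base point [w], and the remainder is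
    [phi w]. *)
Lemma graph_inj : injective (graph WW').
Proof.
move=> phi psi e; apply/lfunP => w; apply/val_inj => /=.
have : graph_map phi w \in (graph WW' psi : {vspace V}).
  by rewrite -e; exact/memv_img/memvf.
case/memv_imgP => w' _ pq.
have ww' : w = w'.
  by apply/val_inj; rewrite /= -(daddv_pi_graph phi) pq daddv_pi_graph.
by move: pq; rewrite -ww' !graph_mapE => /addrI.
Qed.

Lemma graph0 : graph WW' 0 = W.
Proof.
apply/val_inj/vspaceP => v /=; apply/memv_imgP/idP => [[w _ ->]|vW].
  by rewrite graph_mapE zero_lfunE addr0 subvsP.
by exists (vsproj W v); rewrite ?memvf // graph_mapE zero_lfunE addr0 vsprojK.
Qed.

Lemma graph_coord0 : graph_coord WW' 0 = W.
Proof. by rewrite /graph_coord (linear0 (@r2v _ H)) graph0. Qed.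

Lemma graph_coord_inj : injective (graph_coord WW').
Proof. by move=> x y /graph_inj /(can_inj r2vK). Qed.

Lemma graph_projW : graph_proj W W' W = \1%VF.
Proof.
apply/lfunP => w; apply/val_inj.
by rewrite !comp_lfunE !lfunE /= vsprojK ?memv_pi // daddv_pi_id ?subvsP.
Qed.

Lemma tangentE (phi : H) w : tangent phi w = piv W (vsval (phi w)).
Proof. by rewrite !comp_lfunE !lfunE. Qed.

(** As [W + W'] is all of [V], the complement maps onto [V/W], and composing with a right inverse
    lifts [D]. Testing on graph directions therefore reaches every tangent vector. *)
Lemma tangent_surj (D : 'Hom(subvs_of W, quotv W)) :
  exists phi : H, tangent phi = D.
Proof.
pose q : 'Hom(subvs_of W', quotv W) := (linfun (piv W) \o inclusion W')%VF.
have qfull u : u \in limg q.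
  have /memv_addP[w wW [w' wW' e]] : repr u \in (W + W')%VS.
    by case/andP: WW' => /eqP -> _; rewrite memvf.
  apply/memv_imgP; exists (vsproj W' w'); rewrite ?memvf //.
  rewrite comp_lfunE !lfunE /= vsprojK // -[LHS]reprvK; apply/eqP.
  by rewrite piv_eq e addrK.
exists (q^-1 \o D)%VF; apply/lfunP => w.
have -> : tangent (q^-1 \o D)%VF = (q \o (q^-1 \o D))%VF.
  by rewrite /tangent /q !comp_lfunA.
rewrite 2!(@comp_lfunE _ _ _ _ _ _ w); exact: limg_lfunVK.
Qed.

End Graph.

Lemma complementC (R : realType) (V : vectType R) (W : {vspace V}) :
  complement W W^C.
Proof. by rewrite /complement addv_complf capv_compl !eqxx. Qed.

(** * The section in a graph chart and its derivative at 0 *)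

Section Derivative.
Variables (R : realType) (V : vectType R) (m k : nat) (W : grass V m).
Variables (f : symform k V).

(** Moves the section to the fixed fibre over [W], in the frame in which the smoothness of
    trivializations is tested. *)
Lemma restriction_graph (W' : {vspace V}) (WW' : complement W W') phi :
  restriction_section f (graph WW' phi) =
  pullback (graph_proj W W' (graph WW' phi)) (pullback (graph_map phi) f).
Proof.
rewrite -pullback_comp; apply: symform_ext => w /=; congr (f _).
by apply/funext => i; rewrite comp_lfunE graph_map_proj lfunE.
Qed.

(** For a fixed tuple [w] the arguments of [f] are affine in the coordinates of [phi], so the
    Leibniz rule for multilinear forms applies. *)
Lemma pullback_graph_map_is_diff (W' : {vspace V}) (w : 'I_k -> subvs_of W) :
  is_diff (0 : 'rV[R]_(dim 'Hom(subvs_of W, subvs_of W')))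
    (fun x => pullback (graph_map (r2v x)) f w : R)
    (fun h => pullback_derive (inclusion W) (inclusion W' \o r2v h)%VF f w : R).
Proof.
pose L i (x : 'rV[R]_(dim 'Hom(subvs_of W, subvs_of W'))) :=
  (inclusion W' \o r2v x)%VF (w i).
have Llin i : linear (L i).
  move=> a x y; rewrite /L !comp_lfunE.
  rewrite (linearP (@r2v _ 'Hom(subvs_of W, subvs_of W'))).
  by rewrite add_lfunE scale_lfunE linearP.
have H := multilinear_is_diff (symform_multilinear f)
  (fun i => inclusion W (w i)) Llin.
congr (is_diff _ _ _): H; apply/funext => x //=.
by congr (f _); apply/funext => i; rewrite add_lfunE.
Qed.

Hypothesis zW : restriction_section f W = 0.

(** A trivialization is only known to be smooth on frames coming from fixed forms, so the section is
    first expanded in the generators [e t]. *)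
Lemma restriction_is_diff (W' : {vspace V}) (WW' : complement W W') M
  (tau : forall X : grass V m, 'Hom(symform k (subvs_of X), 'rV[R]_M)) :
  local_trivialization WW' tau ->
  is_diff 0
    (fun x =>
       tau (graph_coord WW' x) (restriction_section f (graph_coord WW' x)))
    (fun h =>
       tau W (pullback_derive (inclusion W) (inclusion W' \o r2v h)%VF f)).
Proof.
case=> A [_ A0 _ tauS].
have [e eE] := symform_generators k (subvs_of W).
pose u (t : {ffun 'I_k -> 'I_(\dim {:subvs_of W})}) i :=
  (vbasis {:subvs_of W})`_(t i).
pose T t x := tau (graph_coord WW' x)
  (pullback (graph_proj W W' (graph_coord WW' x)) (e t)).
have T0 t : T t 0 = tau W (e t).
  rewrite /T; move: (graph_coord0 WW'); move: (graph_coord WW' 0) => X XW.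
  by rewrite XW (graph_projW WW') (pullback1 (e t)).
have Td t : is_diff 0 (T t) ('d (T t) 0).
  by apply: differentiableP; case: (tauS (e t) 1%N) => /(_ 0 A0).
have -> : (fun x =>
      tau (graph_coord WW' x) (restriction_section f (graph_coord WW' x))) =
    fun x => \sum_t pullback (graph_map (r2v x)) f (u t) *: T t x.
  apply/funext => x; rewrite restriction_graph {1}[pullback (graph_map _) f]eE.
  by rewrite !linear_sum; apply: eq_bigr => t _; rewrite !linearZ.
(* The second summand, with the derivative of the trivialization, is added to match the product
   rule. Its coefficient is a value of the section at [W], because the graph map of 0 is the
   inclusion, and so it vanishes. *)
have -> : (fun h =>
      tau W (pullback_derive (inclusion W) (inclusion W' \o r2v h)%VF f)) =
    fun h => \sum_t
      (pullback_derive (inclusion W) (inclusion W' \o r2v h)%VF f (u t) *: T t 0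
       + pullback (@graph_map R V W W' (r2v 0)) f (u t) *: 'd (T t) 0 h).
  apply/funext => h; rewrite {1}[pullback_derive _ _ f]eE linear_sum.
  apply: eq_bigr => t _; rewrite linearZ T0.
  suff -> : pullback (@graph_map R V W W' (r2v 0)) f (u t) = 0.
    by rewrite scale0r addr0.
  have /(congr1 (fun g : symform k _ => g (u t))) := zW.
  rewrite (_ : graph_map _ = inclusion W) //.
  rewrite (linear0 (@r2v _ 'Hom(subvs_of W, subvs_of W'))).
  by rewrite /graph_map comp_lfun0r addr0.
apply: is_diff_sum => t _; apply: is_diff_scale => //.
exact: pullback_graph_map_is_diff.
Qed.

End Derivative.

(** * Existence and uniqueness of the intrinsic derivative *)

Section IntrinsicDerivativeFacts.
Variables (R : realType) (V : vectType R) (m k : nat) (W : grass V m).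
Variables (f : symform k V).

Section Vanishing.
Hypothesis zW : restriction_section f W = 0.

Lemma restriction_zero_eval (x : 'I_k -> V) : (forall i, x i \in W) -> f x = 0.
Proof.
move=> xW.
have := congr1 (fun g : symform k _ => g (fun i => vsproj W (x i))) zW.
rewrite /= => e; rewrite -[RHS]e; congr (f _).
by apply/funext => i; rewrite inclusionE vsprojK.
Qed.

(** The difference is a value of [f] with all arguments in [W]. Hence one slot of [f] depends only
    on a class in [V/W] when the other slots are in [W]. *)
Lemma restriction_zero_eq (x : 'I_k -> V) i u v :
  (forall j, x j \in W) -> u - v \in W -> f (dfwith x i u) = f (dfwith x i v).
Proof.
move=> xW uv; rewrite -(subrK v u) (multilinearD (symform_multilinear f)).
by rewrite restriction_zero_eval ?add0r // => j; case: dfwithP.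
Qed.

Lemma intrinsic_derivative_restriction
  (D : 'Hom('Hom(subvs_of W, quotv W), symform k (subvs_of W))) :
  (forall W' (phi : 'Hom(subvs_of W, subvs_of W')), complement W W' ->
     D (tangent phi) =
     pullback_derive (inclusion W) (inclusion W' \o phi)%VF f) ->
  intrinsic_derivative (restriction_section f) D.
Proof.
move=> DE W' WW' N kappa psi M tau [A [B [b [[oA oB A0] kS bS kA kB]]]] tauT.
have kW : (kappa \o graph_coord WW') 0 = kappa W by rewrite /= graph_coord0.
have [/= By0 b0] := kA 0 A0; rewrite graph_coord0 in By0 b0.
(* Differentiating the identity [b (kappa (graph_coord x)) = x], valid near 0, makes the
   differential of [b] a left inverse of that of the transition map. *)
have [db [bd dbk]] : exists db, is_diff (kappa W) b db /\
    forall h, db ('d (kappa \o graph_coord WW') 0 h) = h.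
  have bd : is_diff ((kappa \o graph_coord WW') 0) b
      ('d b ((kappa \o graph_coord WW') 0)).
    by apply: differentiableP; rewrite kW; have [/(_ _ By0)] := bS 1%N.
  have kd : is_diff 0 (kappa \o graph_coord WW')
      ('d (kappa \o graph_coord WW') 0).
    by apply: differentiableP; have [/(_ _ A0)] := kS 1%N.
  have bk : \forall x \near (0 : 'rV[R]_(dim 'Hom(subvs_of W, subvs_of W'))),
      (b \o (kappa \o graph_coord WW')) x = id x.
    by apply: filterS (open_nbhs_nbhs (conj oA A0)) => x /kA[].
  have [_ e1] := is_diff_rV (is_diff_near_eq (is_diff_comp kd bd) bk).
  have [_ e2] := is_diff_rV
    (is_diff_id (0 : 'rV[R]_(dim 'Hom(subvs_of W, subvs_of W')))).
  exists ('d b ((kappa \o graph_coord WW') 0)); rewrite -kW; split=> // h.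
  by rewrite -[LHS]e1 e2.
have dT := restriction_is_diff zW tauT; rewrite -b0 in dT.
have dsigma : is_diff (kappa W)
    (fun y => tau (psi y) (restriction_section f (psi y)))
    (fun h =>
       tau W (pullback_derive (inclusion W) (inclusion W' \o r2v (db h))%VF f)).
  (* On the open set [B] the local expression is the graph-chart expression composed with [b], since
     there [psi y] is [graph_coord (b y)]. *)
  apply: is_diff_near_eq (is_diff_comp bd dT) _.
  apply: filterS (open_nbhs_nbhs (conj oB By0)) => y /kB[_ -> _] //.
have [ds dsE] := is_diff_rV dsigma.
split=> [//|phi]; apply: (etrans (dsE _)).
by rewrite dbk v2rK DE.
Qed.

End Vanishing.

Lemma smooth_on_cst p q (A : set 'rV[R]_p) (c : 'rV[R]_q) : smooth_on A (cst c).
Proof.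
move=> r; elim: r c => [|r IH] c /=; first by move=> x _; exact: cst_continuous.
split=> [x _|v]; first exact: differentiable_cst.
rewrite (_ : (fun x => _) = cst 0); first exact: IH.
by apply/funext => x; rewrite diff_cst.
Qed.

Lemma smooth_on_id p (A : set 'rV[R]_p) : smooth_on A id.
Proof.
case=> [|r] /=; first by move=> x _; exact: cvg_id.
split=> [x _|v]; first exact: ex_diff.
rewrite (_ : (fun x => _) = cst v); first exact: smooth_on_cst.
by apply/funext => x; rewrite diff_val.
Qed.

Lemma intrinsic_derivative_unique (s : section V m k)
  (D D' : 'Hom('Hom(subvs_of W, quotv W), symform k (subvs_of W))) :
  intrinsic_derivative s D -> intrinsic_derivative s D' -> D = D'.
Proof.
move=> sD sD'; apply/lfunP => theta.
have WC := complementC W.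
have [phi <-] := tangent_surj WC theta.
pose gc := graph_coord WC.
(* The inverse of the injective graph parametrization, with default value 0 at subspaces that are
   not graphs. *)
pose kappa X : 'rV[R]_(dim 'Hom(subvs_of W, subvs_of W^C)) :=
  xget 0 [set x | gc x = X].
have kK : cancel gc kappa.
  move=> x; rewrite /kappa; case: xgetP => [y _ /graph_coord_inj //|].
  by move=> /(_ x) /=.
(* Transport of forms to the fibre over [W]. The inverse of [graph_proj] is two-sided at graphs, as
   [K1] and [K2] check; only these matter for the trivialization. *)
pose tau (X : grass V m) :
    'Hom(symform k (subvs_of X), 'rV[R]_(dim (symform k (subvs_of W)))) :=
  linfun (v2r \o pullback (graph_proj W W^C X)^-1%VF).
have tauE (X : grass V m) g :
    tau X g = v2r (pullback ((graph_proj W W^C X)^-1)%VF g).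
  by rewrite lfunE.
have K1 x : (graph_proj W W^C (gc x) \o (graph_proj W W^C (gc x))^-1 = \1)%VF.
  apply/lfunP => w; rewrite comp_lfunE id_lfunE limg_lfunVK //.
  by rewrite graph_proj_full memvf.
have K2 x : ((graph_proj W W^C (gc x))^-1 \o graph_proj W W^C (gc x) = \1)%VF.
  by apply: lker0_compVf; exact: graph_proj_lker0.
have chart : local_chart WC kappa gc.
  exists setT, setT, id; split => //.
  - by split => //; exact: openT.
  - rewrite (_ : kappa \o _ = id); first exact: smooth_on_id.
    exact/funext/kK.
  - exact: smooth_on_id.
have triv : local_trivialization WC tau.
  exists setT; split => //; first exact: openT.
    move=> x _.
    exists (fun y => pullback (graph_proj W W^C (gc x)) (r2v y)) => [g|y].
      by rewrite tauE v2rK -pullback_comp K2 pullback1.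
    by rewrite tauE -pullback_comp K1 pullback1 r2vK.
  (* In the graph frames this trivialization is constant, because the projection and its inverse
     cancel. *)
  move=> g; rewrite (_ : (fun x => _) = cst (v2r g)).
    exact: smooth_on_cst.
  by apply/funext => x; rewrite tauE -pullback_comp K1 pullback1.
have [_ /(_ phi) e] := sD _ WC _ _ _ _ _ chart triv.
have [_ /(_ phi)] := sD' _ WC _ _ _ _ _ chart triv.
rewrite e !tauE => /(can_inj v2rK).
(* Pulling back along the projection at [W] undoes [tau W], so the two values in the fibre agree. *)
move=> /(congr1 (pullback (graph_proj W W^C W))).
rewrite -!pullback_comp; move: (K2 0); rewrite /gc graph_coord0 => ->.
by rewrite !pullback1.
Qed.

End IntrinsicDerivativeFacts.

(** * The formula for the intrinsic derivative *)

Unset Implicit Arguments.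

Theorem lemma26 (R : realType) (V : vectType R) (n m k : nat)
    (dimV : \dim {:V} = n) (hm : (1 <= m <= n)%N) (hk : (1 <= k)%N)
    (f : symform k V) (W : grass V m)
    (zW : restriction_section f W = 0) :
  exists2 ff : 'Hom(quotv W, symform k.-1 (subvs_of W)),
    (forall (v : V) (w : subvs_of W),
       poly_eval (ff (piv W v)) w =
       f (fun i : 'I_k => if val i == 0%N then v else vsval w)) &
    exists2 D : 'Hom('Hom(subvs_of W, quotv W), symform k (subvs_of W)),
      (forall (phi : 'Hom(subvs_of W, quotv W)) (w : subvs_of W),
         poly_eval (D phi) w = k%:R * poly_eval (ff (phi w)) w) &
      unique (@intrinsic_derivative R V m k (restriction_section f) W) D.
Proof.
(* Once [k] is a successor, [k.-1] computes and the slot [ord0] exists. *)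
case: k hk f zW => [//|k] _ f zW.
(* A linear section of the projection V -> V/W. *)
pose rho : 'Hom(quotv W, V) := (linfun (piv W))^-1%VF.
have rhoK q : piv W (rho q) = q.
  rewrite -[LHS](lfunE (piv W)) limg_lfunVK //; apply/memv_imgP.
  by exists (repr q); rewrite ?memvf // lfunE /= reprvK.
have rho_piv v : rho (piv W v) - v \in W by rewrite -piv_eq rhoK.
have slotE v (w : subvs_of W) :
    dfwith (fun=> vsval w) ord0 v =
    fun i : 'I_k.+1 => if val i == 0%N then v else vsval w.
  apply/funext => i; case: dfwithP => [//|j /negPf j0].
  by rewrite -val_eqE eq_sym /= in j0; rewrite j0.
(* The lift of a class is invisible to [f] here: two lifts differ by an element of [W], where [f]
   vanishes. *)
have f_rho v (w : subvs_of W) :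
    f (dfwith (fun=> vsval w) ord0 (rho (piv W v))) =
    f (dfwith (fun=> vsval w) ord0 v).
  by apply: (restriction_zero_eq zW) => // i; exact: subvsP.
pose ffun q := contract (inclusion W) (rho q) f.
have fflin : linear ffun by move=> a q r; rewrite /ffun linearP contract_linear.
pose ffM := GRing.isLinear.Build _ _ _ _ _ fflin.
pose ffL : {linear quotv W -> symform k (subvs_of W)} := HB.pack ffun ffM.
have ffE q w :
    poly_eval (linfun ffL q) w = f (dfwith (fun=> vsval w) ord0 (rho q)).
  rewrite lfunE /poly_eval /= inclusionE fconsE; congr (f _).
  apply: eq_dfwith => j; rewrite eq_sym => /unlift_some[h _].
  by rewrite /fcons => ->.
exists (linfun ffL) => [v w|]; first by rewrite ffE f_rho slotE.
(* The derivative is taken along [rho \o phi], a lift of [phi] from [V/W] to [V]. *)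
pose Dfun phi := pullback_derive (inclusion W) (rho \o phi)%VF f.
have Dlin : linear Dfun.
  move=> a phi psi; rewrite /Dfun -pullback_derive_linear.
  congr pullback_derive; by rewrite comp_lfunDr comp_lfunZr.
pose DM := GRing.isLinear.Build _ _ _ _ _ Dlin.
pose DL : {linear 'Hom(subvs_of W, quotv W) -> symform k.+1 (subvs_of W)} :=
  HB.pack Dfun DM.
exists (linfun DL) => [phi w|].
  rewrite lfunE [LHS](poly_eval_pullback_derive _ _ _ _ ord0) ffE.
  by rewrite inclusionE comp_lfunE.
suff Dder : intrinsic_derivative (restriction_section f) (linfun DL).
  by split=> // D' D'der; exact: intrinsic_derivative_unique Dder D'der.
(* For a graph direction [phi], the vectors [phi w] and [rho (piv W (phi w))] differ by an element
   of [W], so the formulas agree summand by summand. *)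
apply: intrinsic_derivative_restriction => // W' phi _; rewrite lfunE.
apply: symform_ext => w /=; apply: eq_bigr => i _.
apply: (restriction_zero_eq zW) => [j|]; first by rewrite inclusionE subvsP.
by rewrite comp_lfunE tangentE comp_lfunE inclusionE rho_piv.
Qed.
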